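(* Let $G=(V,E)$ be a formal Markov chain (a strongly connected directed graph on a countable node set with free transition variables $q_{u,v}$, $(u,v)\in E$), and let $i,j\in V$ be distinct nodes that are not joint-ancestor free, i.e. $A_i(G\setminus j)\cap A_j(G\setminus i)\neq\emptyset$. Then there exists a node $k\in A_i(G\setminus j)\cap A_j(G\setminus i)$ such that the stationary probability ratio $\pi_i/\pi_j$ depends on at least one of the edge weights emerging from $k$; that is, there exist two instantiations $q^{a}$ and $q^{b}$ of the formal Markov chain with $q^a_{u,v}=q^b_{u,v}$ for all $(u,v)\in E$ with $u\neq k$, whose stationary measures $\pi^a,\pi^b$ satisfy $\pi^a_i/\pi^a_j\neq \pi^b_i/\pi^b_j$.
   Context: A directed graph is a pair $G=(V,E)$ with $V$ countable (finite or infinite) and $E\subseteq V\times V$ (self-loops allowed). A path is a sequence $v_1,\dots,v_n$ ($n\ge1$) of distinct nodes with $(v_p,v_{p+1})\in E$ for all $p<n$; $n=1$ is allowed. $G$ is strongly connected if there is a path from every node to every node. $G\setminus u$ is the subgraph obtained by deleting node $u$ and all its incident edges. $A_i(H)$ denotes the set of all nodes from which there is a path to $i$ in the graph $H$ (so $i\in A_i(H)$). A formal Markov chain is a strongly connected directed graph $G=(V,E)$ together with free variables $q_{u,v}$, $(u,v)\in E$ (edge weights). An instantiation is an assignment of real values $q_{u,v}>0$ to all $(u,v)\in E$ (with $q_{u,v}=0$ for $(u,v)\notin E$), interpreted either as transition rates of a continuous-time chain (with $\sum_v q_{u,v}<\infty$ for each $u$) or as transition probabilities of a discrete-time chain (with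 $\sum_v q_{u,v}=1$ for each $u$); the statement is meant under either convention. A stationary measure of an instantiation is a family $(\pi_u)_{u\in V}$ of positive reals with $\pi_u\sum_{v:(u,v)\in E}q_{u,v}=\sum_{v:(v,u)\in E}\pi_v q_{v,u}$ for all $u\in V$. Instantiations considered are the recurrent ones (the jump chain with transition probabilities $q_{u,v}/\sum_w q_{u,w}$ is recurrent; automatic when $V$ is finite), so that $\pi$ is unique up to a positive factor and the ratio $\pi_i/\pi_j$ is well defined. *)

(* Defs.v *)
From HB Require Import structures.
From mathcomp Require Import all_boot all_order all_algebra.
From mathcomp Require Import all_classical all_reals ereal topology normedtype.
From mathcomp Require Import sequences esum.

Set Implicit Arguments.
Unset Strict Implicit.
Unset Printing Implicit Defensive.

Import Order.TTheory GRing.Theory Num.Theory.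

Local Open Scope classical_set_scope.
Local Open Scope ring_scope.
Local Open Scope ereal_scope.

Section Digraphs.
Variables (V : countType) (E : rel V).

(* A path x :: p from x to y in the subgraph of (V, E) induced by the node set
   D.  In particular p = [::] is the one-node path, available iff D x. *)
Definition dipath (D : pred V) (x y : V) (p : seq V) : bool :=
  [&& path E x p, last x p == y, uniq (x :: p) & all D (x :: p)].

Definition strongly_connected : Prop :=
  forall x y : V, exists p : seq V, dipath predT x y p.

Definition ancestors (D : pred V) (i : V) : set V :=
  [set x | exists p : seq V, dipath D x i p].

(* A_i(G \ u): deleting u and its incident edges leaves the subgraph induced
   by the nodes other than u. *)
Definition ancestors_del (u i : V) : set V := ancestors (predC1 u) i.

Definition joint_ancestors (i j : V) : set V :=
  ancestors_del j i `&` ancestors_del i j.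

End Digraphs.

Inductive convention := ContinuousTime | DiscreteTime.

Section Instantiations.
Variables (R : realType) (V : countType) (E : rel V).
Implicit Types (q : V -> V -> R) (pi : V -> R) (u v x y : V).

Definition out_weight q u : \bar R := \esum_(v in [set v | E u v]) (q u v)%:E.

Definition instantiation (c : convention) q : Prop :=
  [/\ forall u v, E u v -> (0 < q u v)%R,
      forall u v, ~~ E u v -> q u v = 0%R
    & forall u, match c return Prop with
                | ContinuousTime => out_weight q u < +oo
                | DiscreteTime => out_weight q u = 1
                end].

Definition jump_prob q u v : R := (q u v / fine (out_weight q u))%R.

(* The probability that the jump chain started at x visits u for the first time
   after time 0 at time n.+1. *)
Fixpoint first_passage q (u : V) (n : nat) (x : V) : \bar R :=
  if n is m.+1 then
    \esum_(y in [set y | y != u]) ((jump_prob q x y)%:E * first_passage q u m y)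
  else (jump_prob q x u)%:E.

(* The chain returns to its starting node almost surely. *)
Definition recurrent q : Prop :=
  forall u, \sum_(0 <= n <oo) first_passage q u n u = 1.

Definition stationary_measure q pi : Prop :=
  (forall u, (0 < pi u)%R) /\
  forall u, (pi u)%:E * out_weight q u =
            \esum_(v in [set v | E v u]) (pi v * q v u)%:E.

(* The ratio pi_i / pi_j is well defined and equal to r: a stationary measure
   exists, and every stationary measure has this ratio. *)
Definition stationary_ratio q (i j : V) (r : R) : Prop :=
  (exists pi, stationary_measure q pi) /\
  (forall pi, stationary_measure q pi -> (pi i / pi j)%R = r).

Definition ratio_depends_on (c : convention) (i j k : V) : Prop :=
  exists qa qb : V -> V -> R,
    [/\ instantiation c qa /\ recurrent qa,
        instantiation c qb /\ recurrent qb,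
        forall u v, E u v -> u != k -> qa u v = qb u v
      & exists ra rb : R,
          [/\ stationary_ratio qa i j ra, stationary_ratio qb i j rb
            & ra <> rb]].

End Instantiations.

(* Main.v *)
From HB Require Import structures.
Require Import Defs.
From mathcomp Require Import all_boot all_order all_algebra.
From mathcomp Require Import all_classical all_reals ereal topology normedtype.
From mathcomp Require Import sequences esum ring lra.

(** The two instantiations are stochastic kernels [P] and [Q]: with row sums 1
they are admissible under both conventions and equal their own jump chains.

Why the ratio moves.  Take [h] with values in [0, 1], [h i = 1], [h j = 0],
harmonic for [P] off [i] and [j], equal to 1 at the nodes that cannot reach
[j] without meeting [i], and to 0 at those that cannot reach [i] without
meeting [j] ([harmonic_separation]).  If every joint ancestor had the same
value of [h] as all its out-neighbours, then following a path from a joint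
ancestor to [i] would give the value 1, and following one to [j] the value 0.
So some joint ancestor [k] has an edge to a node [b] with [h b <> h k]
([joint_ancestor_choice]).  Let [Q] be [P] with row [k] replaced by its average
with the unit mass at [b].  Let [nu] be the stationary measure with [nu j = 1].
Summing [nu x * (mean h x - h x)] over all nodes gives 0
([harmonic_excursion_eq]): for [P] this says
[nu_P i = nu_P i * mean h i + mean h j], and for [Q] there is the additional
term [nu_Q k * (mean Q h k - h k)], which is not 0.  The means at [i] and [j]
are the same for both kernels since [k] is neither, so [nu_P i <> nu_Q i].

What an infinite node set adds.

A recurrent kernel must exist on every strongly connected countable graph.  Each
row is concentrated on an edge that decreases the distance [d] to a root,
leaving at most [1 / (d + 1)^2] to the other edges.  These bounds are summable
along a descending path, so the root is reached with probability at least 1/2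
from everywhere ([hit_certain_of_descent]); and a hitting probability that is
bounded away from 0 is identically 1, because the chain gets a fresh chance for
ever ([hit_certain_of_half]).  A minimum principle carries certainty from one
target to all others ([hit_certain_all]); since the passage to [k] does not
use row [k], it also carries it from [P] to [Q] ([hit_certain_change_row]).

The measure [nu] counts the expected visits during an excursion from [j].
It is invariant because the excursion ends almost surely, and every invariant
measure is a multiple of it because it is the least one with mass 1 at [j]
([excursion_measure_minimal], [invariant_ratio]).

As [nu] may have infinite total mass, the sum of [nu x * (mean h x - h x)]
cannot be rearranged directly.  It is telescoped along the excursion instead,
with a remainder bounded by the probability that the excursion is still
running ([harmonic_balance]).  Subtraction is avoided throughout: identities are
written with nonnegative terms on both sides, so that all sums converge
unconditionally in the extended reals. *)

Set Implicit Arguments.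
Unset Strict Implicit.
Unset Printing Implicit Defensive.

Import Order.TTheory GRing.Theory Num.Theory.

Local Open Scope classical_set_scope.
Local Open Scope ring_scope.
Local Open Scope ereal_scope.

(** * Sums of nonnegative extended reals *)
Section NonnegativeSums.
Variable R : realType.

Lemma esum_term (T : choiceType) (f : T -> \bar R) x : (forall y, 0 <= f y) ->
  f x <= \esum_(y in setT) f y.
Proof.
move=> f0; apply: esum_ge; exists [set x]; last by rewrite fsbig_set1.
by split.
Qed.

Lemma esum_exchange (T1 T2 : choiceType) (a : T1 -> T2 -> \bar R) :
  (forall x y, 0 <= a x y) ->
  \esum_(x in setT) \esum_(y in setT) a x y =
  \esum_(y in setT) \esum_(x in setT) a x y.
Proof.
move=> a0; rewrite !esum_esum//.
rewrite (reindex_esum (setT `*`` (fun=> setT)) _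
  (fun z : T2 * T1 => (z.2, z.1)))//.
split=> //= [[x1 y1] [x2 y2] _ _ [-> ->]//|[x y] _].
by exists (y, x).
Qed.

Lemma esum_nneseries (T : choiceType) (a : T -> nat -> \bar R) :
  (forall x n, 0 <= a x n) ->
  \esum_(x in setT) \sum_(0 <= n <oo) a x n =
  \sum_(0 <= n <oo) \esum_(x in setT) a x n.
Proof.
move=> a0; rewrite nneseries_esumT; last by move=> n; apply: esum_ge0.
rewrite -esum_exchange//; apply: eq_esum => x _.
by rewrite nneseries_esumT.
Qed.

(** Allowing an infinite factor spares later rearrangements of sums any proof of
finiteness. *)
Lemma esumZl (T : choiceType) (c : \bar R) (f : T -> \bar R) :
  0 <= c -> (forall x, 0 <= f x) ->
  \esum_(x in setT) c * f x = c * \esum_(x in setT) f x.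
Proof.
have le d (g : T -> \bar R) : 0 <= d -> (forall x, 0 <= g x) ->
    \esum_(x in setT) d * g x <= d * \esum_(x in setT) g x.
  move=> d0 g0; apply: ge_ereal_sup => _ [X [finX _] <-].
  rewrite -ge0_mule_fsumr//; apply: lee_wpmul2l => //.
  by apply: esum_ge; exists X.
move=> c0 f0; apply/eqP; rewrite eq_le le//=.
move: c c0 => [c|_|//].
  move=> c0; rewrite lee_fin le_eqVlt in c0; case/orP: c0 => [/eqP<-|c0].
    by rewrite mul0e esum_ge0// => x _; rewrite mul0e.
  have ge0 x : 0 <= c%:E * f x by rewrite mule_ge0// lee_fin ltW.
  have := le c^-1%:E _ _ ge0.
  rewrite lee_fin invr_ge0 (ltW c0) => /(_ isT).
  rewrite -[X in X <= _ -> _](_ : \esum_(x in setT) f x = _); last first.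
    by apply: eq_esum => x _; rewrite muleA -EFinM mulVf ?mul1e// gt_eqF.
  rewrite -(@lee_pmul2l _ c%:E) ?fin_numE// ?lte_fin//.
  by rewrite muleA -EFinM divff ?mul1e// gt_eqF.
(* The factor is infinite: the sum is infinite unless [f] vanishes. *)
have [f00|] := pselect (forall x, f x = 0).
  rewrite (esum1 (fun x _ => f00 x)) mule0 esum_ge0// => x _.
  by rewrite f00 mule0.
move=> /existsNP[x /eqP fx].
have fx0 : 0 < f x by rewrite lt_def fx f0.
have -> : \esum_(x in setT) +oo * f x = +oo; last by rewrite leey.
apply/eqP; rewrite -leye_eq -[leLHS](gt0_mulye fx0).
by apply: (@esum_term _ (fun x => +oo * f x)) => y; rewrite mule_ge0.
Qed.

Lemma nneseries_le (f : nat -> \bar R) (c : \bar R) : (forall n, 0 <= f n) ->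
  (forall N, \sum_(0 <= n < N) f n <= c) -> \sum_(0 <= n <oo) f n <= c.
Proof.
move=> f0 fc; apply: lime_le; last exact: nearW.
exact: is_cvg_nneseries.
Qed.

Lemma nneseries_shift (f : nat -> \bar R) : (forall n, 0 <= f n) ->
  \sum_(0 <= n <oo) f n = f 0%N + \sum_(0 <= n <oo) f n.+1.
Proof.
move=> f0; rewrite nneseries_recl//; congr (_ + _).
rewrite -(@nneseries_addn _ _ 1)//; apply: eq_eseriesr => n _.
by rewrite addn1.
Qed.

End NonnegativeSums.

(** * Measures, functions and kernels *)
Section Kernels.
Variables (R : realType) (V : countType).
Implicit Types (P Q : V -> V -> R) (f g m : V -> \bar R) (r u x y : V).

Definition pairing m f := \esum_(x in setT) m x * f x.
Definition mean P f x := pairing (fun y => (P x y)%:E) f.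
Definition push P m y := pairing m (fun x => (P x y)%:E).
(** Killing at [u]: [mean P (off u f)] ignores the transitions into [u], and
[off u (push P m)] removes the mass that has arrived there. *)
Definition off u f y := if y == u then 0 else f y.
Definition at_node u (c : \bar R) : V -> \bar R :=
  fun y => if y == u then c else 0.

Definition stochastic P :=
  (forall x y, (0 <= P x y)%R) /\ (forall x, mean P (cst 1) x = 1).

Lemma off_ge0 u f : (forall y, 0 <= f y) -> forall y, 0 <= off u f y.
Proof. by move=> f0 y; rewrite /off; case: ifP. Qed.

Lemma at_node_ge0 u c : 0 <= c -> forall y, 0 <= at_node u c y.
Proof. by move=> c0 y; rewrite /at_node; case: ifP. Qed.

Lemma pairing_ge0 m f : (forall x, 0 <= m x) -> (forall x, 0 <= f x) ->
  0 <= pairing m f.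
Proof. by move=> m0 f0; apply: esum_ge0 => x _; rewrite mule_ge0. Qed.

Lemma pairing_le m f g : (forall x, 0 <= m x) -> (forall x, f x <= g x) ->
  pairing m f <= pairing m g.
Proof. by move=> m0 fg; apply: le_esum => x _; rewrite lee_wpmul2l. Qed.

Lemma pairingC m f : pairing m f = pairing f m.
Proof. by apply: eq_esum => x _; rewrite muleC. Qed.

Lemma pairingD m f g : (forall x, 0 <= m x) -> (forall x, 0 <= f x) ->
  (forall x, 0 <= g x) -> pairing m (f \+ g) = pairing m f + pairing m g.
Proof.
move=> m0 f0 g0; rewrite /pairing -esumD => [|x _|x _]; rewrite ?mule_ge0//.
by apply: eq_esum => x _; rewrite ge0_muleDr.
Qed.

Lemma pairing_term m f x : (forall y, 0 <= m y) -> (forall y, 0 <= f y) ->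
  m x * f x <= pairing m f.
Proof.
move=> m0 f0; apply: (@esum_term _ _ (fun x => m x * f x)) => y.
by rewrite mule_ge0.
Qed.

Lemma pairing_at m u c : 0 <= m u * c -> pairing m (at_node u c) = m u * c.
Proof.
move=> c0; rewrite -(@esum_set1 _ _ u (fun=> m u * c))// esum_mkcond.
apply: eq_esum => x _; rewrite /at_node.
have [->|xu] := eqVneq x u; first by rewrite mem_set.
by rewrite memNset ?mule0//= => /eqP; rewrite (negPf xu).
Qed.

Lemma pairing_split m f u : (forall y, 0 <= m y) -> (forall y, 0 <= f y) ->
  pairing m f = m u * f u + pairing m (off u f).
Proof.
move=> m0 f0; rewrite -pairing_at ?mule_ge0// -pairingD//; first last.
- by apply: off_ge0.
- by apply: at_node_ge0.
- congr pairing; apply/funext => x; rewrite /= /at_node /off.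
  by have [->|] := eqVneq x u; rewrite ?adde0 ?add0e.
Qed.

Lemma pairingZ m f c :
  (forall x, 0 <= m x) -> (forall x, 0 <= f x) -> 0 <= c ->
  pairing m (fun x => c * f x) = c * pairing m f.
Proof.
move=> m0 f0 c0; rewrite -esumZl// => [|x]; last by rewrite mule_ge0.
by apply: eq_esum => x _; rewrite muleCA.
Qed.

Lemma pairing_nneseries m (f : nat -> V -> \bar R) :
  (forall x, 0 <= m x) -> (forall n x, 0 <= f n x) ->
  pairing m (fun x => \sum_(0 <= n <oo) f n x) =
  \sum_(0 <= n <oo) pairing m (f n).
Proof.
move=> m0 f0; rewrite -esum_nneseries; last by move=> x n; rewrite mule_ge0.
apply: eq_esum => x _; rewrite !nneseries_esumT ?esumZl// => n.
by rewrite mule_ge0.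
Qed.

Lemma pairing_suml (m : nat -> V -> \bar R) f N :
  (forall x, 0 <= f x) -> (forall n x, 0 <= m n x) ->
  pairing (fun x => \sum_(0 <= n < N) m n x) f =
  \sum_(0 <= n < N) pairing (m n) f.
Proof.
move=> f0 m0; rewrite -esum_sum => [|x n _ _]; last by rewrite mule_ge0.
by apply: eq_esum => x _; rewrite ge0_sume_distrl.
Qed.

End Kernels.

(** * Induction along edges of a strongly connected graph *)
Section Reachability.
Variables (V : countType) (E : rel V).

Lemma forward_ind (S : V -> Prop) r : strongly_connected E ->
  S r -> (forall x y, E x y -> S x -> S y) -> forall x, S x.
Proof.
move=> sc Sr step x; have [p /and4P[pp /eqP <- _ _]] := sc r x.
elim: p r Sr pp => //= y p IHp r Sr /andP[Ery pp].
exact: (IHp y (step _ _ Ery Sr)).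
Qed.

Lemma backward_ind (S : V -> Prop) r : strongly_connected E ->
  S r -> (forall x y, E x y -> S y -> S x) -> forall x, S x.
Proof.
move=> sc Sr step x; have [p /and4P[pp /eqP lp _ _]] := sc x r.
elim: p x lp pp => /= [x -> //|y p IHp x lp /andP[Exy pp]].
exact: step Exy (IHp _ lp pp).
Qed.

End Reachability.

(** * Hitting probabilities and recurrence *)
Section Hitting.
Variables (R : realType) (V : countType).
Implicit Types (P Q : V -> V -> R) (f g m : V -> \bar R) (r u x y : V).

Fixpoint passage P u n x : \bar R :=
  if n is n'.+1 then mean P (off u (passage P u n')) x else (P x u)%:E.

Definition hit_within P u N x := \sum_(0 <= n < N) passage P u n x.
Definition hit P u x := \sum_(0 <= n <oo) passage P u n x.

Section OneKernel.
Variable P : V -> V -> R.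
Hypothesis stochP : stochastic P.

Let row0 x y : 0 <= (P x y)%:E. Proof. by rewrite lee_fin; case: stochP. Qed.
Hint Resolve row0 : core.

Lemma mean_ge0 f x : (forall y, 0 <= f y) -> 0 <= mean P f x.
Proof. by move=> f0; apply: pairing_ge0. Qed.

Lemma mean_le f g x : (forall y, f y <= g y) -> mean P f x <= mean P g x.
Proof. by move=> fg; apply: pairing_le. Qed.

Lemma mean_split f u x : (forall y, 0 <= f y) ->
  mean P f x = (P x u)%:E * f u + mean P (off u f) x.
Proof. by move=> f0; apply: pairing_split. Qed.

Lemma passage_ge0 u n x : 0 <= passage P u n x.
Proof.
elim: n x => [|n IHn] x /=; first exact: row0.
by apply: mean_ge0; apply: off_ge0.
Qed.
Hint Resolve passage_ge0 : core.

Lemma hit_within_ge0 u N x : 0 <= hit_within P u N x.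
Proof. by apply: sume_ge0. Qed.

Lemma hit_ge0 u x : 0 <= hit P u x.
Proof. by apply: nneseries_ge0. Qed.
Hint Resolve hit_within_ge0 hit_ge0 : core.

(** First-step analysis; [hitE] is its limit, which holds by exchanging two sums
of nonnegative terms. *)
Lemma hit_withinS u N x :
  hit_within P u N.+1 x = (P x u)%:E + mean P (off u (hit_within P u N)) x.
Proof.
elim: N x => [|N IHN] x.
  rewrite /hit_within big_nat1 /= [mean _ _ _]esum1 ?adde0// => y _.
  by rewrite /off big_geq// if_same mule0.
rewrite /hit_within big_nat_recr//= [X in X + _]IHN -addeA.
rewrite -[X in _ + X]pairingD//; try exact: off_ge0.
congr (_ + pairing _ _); apply/funext => y /=.
rewrite /off; case: ifP => _; first by rewrite adde0.
by rewrite /hit_within big_nat_recr.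
Qed.

Lemma hitE u x : hit P u x = (P x u)%:E + mean P (off u (hit P u)) x.
Proof.
rewrite /hit nneseries_shift//=; congr (_ + _).
rewrite -[LHS]pairing_nneseries//; last by move=> n; apply: off_ge0.
congr pairing; apply/funext => y; rewrite /off; case: ifP => // _.
by rewrite eseries0.
Qed.

Lemma mean_split1 u x : (P x u)%:E + mean P (off u (cst 1)) x = 1.
Proof.
by rewrite -[X in X + _]mule1 -(@mean_split (cst 1))//; case: stochP.
Qed.

Lemma hit_le1 u x : hit P u x <= 1.
Proof.
apply: nneseries_le => // N.
suff : hit_within P u N x <= 1 by [].
elim: N x => [|N IHN] x; first by rewrite /hit_within big_geq.
rewrite hit_withinS -(mean_split1 u x) leeD2l// mean_le// => y.
by rewrite /off; case: ifP.
Qed.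

Lemma hit_fin u x : hit P u x \is a fin_num.
Proof. by rewrite ge0_fin_numE// (le_lt_trans (hit_le1 _ _))// ltry. Qed.

(** Let [s] be the probability of not having hit [u] within [N] steps.
Avoiding [u] for ever means surviving [N] steps and then avoiding [u] from the
current node, which has probability at most 1/2, so [1 - hit <= s / 2] for all
[N]; since [s] decreases to [1 - hit], this forces [hit = 1].  The key
inequality states [1 - hit <= s / 2] without subtraction. *)
Lemma hit_certain_of_half u :
  (forall x, 1 <= hit P u x + hit P u x) -> forall x, hit P u x = 1.
Proof.
move=> half x; apply/eqP; rewrite eq_le hit_le1/=.
suff key N y : 1 + hit_within P u N y <= hit P u y + hit P u y.
  have : hit P u x <= hit P u x + hit P u x - 1.
    by apply: nneseries_le => // N; rewrite leeBrDr// addeC; exact: key.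
  by rewrite leeBrDr// leeD2lE ?hit_fin.
elim: N y => [|N IHN] y; first by rewrite /hit_within big_geq// adde0.
rewrite hit_withinS -{1}(mean_split1 u y) hitE addeACA [leRHS]addeACA leeD2l//.
rewrite -!pairingD//; try exact: off_ge0.
apply: pairing_le => // z /=; rewrite /off; case: ifP => // _.
Qed.

(** Optional stopping at the first visit to [r]: the value of a nonnegative
superharmonic function at [x] is at least its mean value at that time, which is
[f r] when the visit is certain. *)
Lemma superharmonic_ge_target r f :
  (forall x, 0 <= f x) -> (forall x, mean P f x <= f x) ->
  (forall x, hit P r x = 1) -> forall x, f r <= f x.
Proof.
move=> f0 sup hit1 x; rewrite -[f r]mul1e -(hit1 x).
have ser : hit P r x * f r = \sum_(0 <= n <oo) f r * passage P r n x.
  rewrite muleC /hit !nneseries_esumT ?esumZl// => n.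
  by rewrite mule_ge0.
rewrite ser; apply: nneseries_le => [n|N]; first by rewrite mule_ge0.
rewrite -ge0_sume_distrr// -/(hit_within P r N x).
elim: N x {ser} => [|N IHN] x; first by rewrite /hit_within big_geq// mule0.
rewrite hit_withinS ge0_muleDr//; last by apply/mean_ge0/off_ge0.
apply: le_trans (sup x); rewrite [leRHS](mean_split r _ f0) muleC leeD2l//.
rewrite -[X in X <= _]pairingZ//; last by apply: off_ge0.
by apply: pairing_le => // y; rewrite /off; case: ifP => // _; rewrite mule0.
Qed.

Lemma mean_cst c x : 0 <= c -> mean P (cst c) x = c.
Proof.
move=> c0; rewrite -[RHS]mule1; case: stochP => _ /(_ x) <-.
rewrite -[RHS]pairingZ//; apply: eq_esum => y _ /=.
by rewrite mule1.
Qed.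

(** A mean equal to the minimum leaves no room for a larger value at a node of
positive weight. *)
Lemma min_principle f c x y : (forall z, c%:E <= f z) -> (0 <= c)%R ->
  mean P f x <= c%:E -> (0 < P x y)%R -> f y = c%:E.
Proof.
move=> cf c0 mfc Pxy.
apply/eqP; rewrite eq_le cf andbT leNgt; apply/negP => cfy.
have f0 z : 0 <= f z by apply: le_trans (cf z); rewrite lee_fin.
suff : c%:E < mean P f x by rewrite ltNge mfc.
rewrite (mean_split y)//.
rewrite -(@mean_cst c%:E x)// (@mean_split (cst c%:E) y)//.
apply: lte_leD.
- rewrite ge0_fin_numE; last by apply/mean_ge0/off_ge0.
  apply: (@le_lt_trans _ _ c%:E); last by rewrite ltry.
  rewrite -[leRHS](@mean_cst c%:E x)//; apply: mean_le => z.
  by rewrite /off; case: ifP.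
- by rewrite lte_pmul2l ?lte_fin// fin_numE.
- by apply: mean_le => z; rewrite /off; case: ifP.
Qed.

(** The probability of visiting [u] at a time [n >= 0], whereas [hit] only
counts times [n >= 1].  This version is superharmonic. *)
Definition hit_or_at u y := if y == u then 1 else hit P u y.

Lemma hit_or_at_ge0 u y : 0 <= hit_or_at u y.
Proof. by rewrite /hit_or_at; case: ifP. Qed.

Lemma mean_hit_or_at u x : mean P (hit_or_at u) x = hit P u x.
Proof.
rewrite (mean_split u); last exact: hit_or_at_ge0.
rewrite {1}/hit_or_at eqxx mule1 [RHS]hitE; congr (_ + mean _ _ _).
by apply/funext => z; rewrite /off /hit_or_at; case: eqVneq.
Qed.

(** The probability of visiting [u] is superharmonic, hence minimal at [r].  By
the minimum principle it takes the same value at all successors of [r], and so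
at every node; at [u] it is 1. *)
Lemma hit_certain_all (E : rel V) r : strongly_connected E ->
  (forall x y, E x y -> (0 < P x y)%R) ->
  (forall x, hit P r x = 1) -> forall u x, hit P u x = 1.
Proof.
move=> sc Epos hit1 u x; pose f := hit_or_at u.
have f0 y : 0 <= f y by apply: hit_or_at_ge0.
have fsup y : mean P f y <= f y.
  by rewrite mean_hit_or_at /f /hit_or_at; case: ifP => // _; exact: hit_le1.
have frmin y : f r <= f y by apply: superharmonic_ge_target.
have ffin y : f y \is a fin_num.
  by rewrite /f /hit_or_at; case: ifP => // _; exact: hit_fin.
have fconst y : f y = f r.
  move: y; apply: (forward_ind sc (r := r)) => [//|y z Eyz fy].
  rewrite -(fineK (ffin r)); apply: (@min_principle f _ y z).
  - by move=> w; rewrite fineK.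
  - by rewrite fine_ge0.
  - by rewrite fineK// -fy.
  - exact: Epos.
have f1 y : f y = 1 by rewrite fconst -(fconst u) /f /hit_or_at eqxx.
rewrite -mean_hit_or_at -/f (_ : f = cst 1); last exact/funext.
by case: stochP.
Qed.

(** Going straight down has probability at least the product of the
[1 - 1 / (n + 1)^2] for [1 <= n <= d x], which telescopes to
[(d x + 2) / (2 * (d x + 1)) >= 1/2]. *)
Lemma hit_certain_of_descent r (d : V -> nat) (next : V -> V) :
  (forall x, x != r -> (d (next x) < d x)%N) ->
  (forall x, x != r -> (1 - (d x).+1%:R^-1 ^+ 2 <= P x (next x))%R) ->
  forall x, hit P r x = 1.
Proof.
move=> desc Pnext.
(* The value of the telescoping product. *)
pose l (n : nat) : R := ((1 + n.+1%:R^-1) / 2)%R.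
have bound y : (l (d y))%:E <= hit_or_at r y.
  have [n] := ubnP (d y); elim: n y => // n IHn y dy.
  rewrite /hit_or_at; case: eqVneq => [_|yr].
    rewrite lee_fin /l ler_pdivrMr ?ltr0n// mul1r (_ : 2 = 1 + 1)%R//.
    by rewrite lerD2l invf_le1 ?ltr0n// ler1n.
  have dn := desc _ yr.
  rewrite -mean_hit_or_at.
  apply: (@le_trans _ _ ((P y (next y))%:E * hit_or_at r (next y))).
    apply: (@le_trans _ _ ((P y (next y))%:E * (l (d (next y)))%:E)).
      rewrite -EFinM lee_fin.
      have [D dE] : exists D, d y = D.+1 by case: (d y) dn => // D _; exists D.
      rewrite dE ltnS in dn.
      apply: (@le_trans _ _ ((1 - (d y).+1%:R^-1 ^+ 2) * l D)%R); last first.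
        have lD : (0 <= l D)%R by rewrite /l divr_ge0// addr_ge0// invr_ge0.
        apply: ler_pM => //.
        - rewrite subr_ge0 exprn_ile1// ?invr_ge0// invf_le1 ?ltr0n//.
          by rewrite ler1n.
        - exact: Pnext.
        - by rewrite /l ler_pM2r// lerD2l lef_pV2 ?posrE ?ltr0n// ler_nat.
      rewrite dE /l mulrA ler_pM2r//.
      have D0 : (0 <= D%:R :> R)%R by [].
      rewrite -(natr1 D.+1) -(natr1 D) le_eqVlt; apply/orP; left; apply/eqP.
      field.
      by rewrite !natr1 !pnatr_eq0.
    by apply: lee_wpmul2l => //; apply: IHn; apply: leq_trans dn _.
  apply: (@pairing_term _ _ (fun z => (P y z)%:E)) => // z.
  exact: hit_or_at_ge0.
apply: hit_certain_of_half => x.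
have half : (2^-1)%:E <= hit P r x.
  rewrite -mean_hit_or_at -(@mean_cst (2^-1)%:E x) ?lee_fin ?invr_ge0//.
  apply: mean_le => y; apply: le_trans (bound y).
  by rewrite lee_fin /l -[leLHS]mul1r ler_pM2r// lerDl invr_ge0.
apply: le_trans (leeD half half).
by rewrite -EFinD lee_fin [leLHS]splitr !mul1r.
Qed.

End OneKernel.

(** The passage to [k] from elsewhere never uses row [k]. *)
Lemma hit_certain_change_row P Q k : stochastic P -> stochastic Q ->
  (forall x y, x != k -> Q x y = P x y) ->
  (forall x, hit P k x = 1) -> forall x, hit Q k x = 1.
Proof.
move=> sP sQ QP hit1.
have passQP n x : x != k -> passage Q k n x = passage P k n x.
  elim: n x => [|n IHn] x xk /=; first by rewrite QP.
  apply: eq_esum => y _; rewrite QP// /off; case: eqVneq => // yk.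
  by rewrite IHn.
have hitQP x : x != k -> hit Q k x = 1.
  by move=> xk; rewrite -(hit1 x); apply: eq_eseriesr => n _; rewrite passQP.
move=> x; have [->|/hitQP//] := eqVneq x k.
rewrite hitE// -[RHS](mean_split1 sQ k k); congr (_ + pairing _ _).
by apply/funext => y; rewrite /off; case: eqVneq => // /hitQP.
Qed.

End Hitting.

(** * The excursion measure *)
Section Excursions.
Variables (R : realType) (V : countType).
Implicit Types (P Q : V -> V -> R) (f g m : V -> \bar R) (r u x y : V).

Lemma pairing_push P m f : (forall x y, (0 <= P x y)%R) ->
  (forall x, 0 <= m x) -> (forall x, 0 <= f x) ->
  pairing (push P m) f = pairing m (mean P f).
Proof.
move=> P0 m0 f0; have PE0 x y : 0 <= (P x y)%:E by rewrite lee_fin.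
transitivity (\esum_(y in setT) \esum_(x in setT) m x * ((P x y)%:E * f y)).
  apply: eq_esum => y _.
  rewrite muleC -esumZl// => [|x]; last by rewrite mule_ge0.
  by apply: eq_esum => x _; rewrite muleC muleA.
rewrite esum_exchange => [|x y]; last by rewrite !mule_ge0.
by apply: eq_esum => x _; rewrite esumZl// => y; rewrite mule_ge0.
Qed.

Section OneKernel.
Variables (P : V -> V -> R) (j : V).
Hypothesis stochP : stochastic P.

Let P0 x y : (0 <= P x y)%R. Proof. by case: stochP. Qed.
Let row0 x y : 0 <= (P x y)%:E. Proof. by rewrite lee_fin. Qed.
Hint Resolve P0 row0 : core.

Lemma push_ge0 m y : (forall x, 0 <= m x) -> 0 <= push P m y.
Proof. by move=> m0; apply: pairing_ge0. Qed.

Lemma push_term m x y : (forall x, 0 <= m x) -> m x * (P x y)%:E <= push P m y.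
Proof. by move=> m0; apply: (@pairing_term _ _ m (fun x => (P x y)%:E)). Qed.

(** The law of the chain started at [j], at time [n], on the event that it has
not returned to [j] at the times [1, ..., n]. *)
Fixpoint excursion n y : \bar R :=
  if n is n'.+1 then off j (push P (excursion n')) y else at_node j 1 y.

Definition excursion_measure y := \sum_(0 <= n <oo) excursion n y.

Lemma excursion_ge0 n y : 0 <= excursion n y.
Proof.
elim: n y => [|n IHn] y /=; first by rewrite at_node_ge0.
by apply: off_ge0 => x; exact: push_ge0.
Qed.
Hint Resolve excursion_ge0 : core.

Lemma excursion_measure_ge0 y : 0 <= excursion_measure y.
Proof. by apply: nneseries_ge0. Qed.
Hint Resolve excursion_measure_ge0 : core.

Lemma pairing_offC m f : pairing (off j m) f = pairing m (off j f).
Proof.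
apply: eq_esum => x _; rewrite /off; case: ifP => _ //.
by rewrite mul0e mule0.
Qed.

(** Forward and backward evolution of the killed chain are adjoint; this relates
[excursion], which grows at the end, to [passage], which grows at the start. *)
Lemma pairing_excursionS n f : (forall x, 0 <= f x) ->
  pairing (excursion n.+1) f = pairing (excursion n) (mean P (off j f)).
Proof.
by move=> f0; rewrite pairing_offC pairing_push//; exact: off_ge0.
Qed.

Lemma pairing_excursion0 f : 0 <= f j -> pairing (excursion 0) f = f j.
Proof. by move=> f0; rewrite pairingC pairing_at ?mule1. Qed.

Lemma excursion_return n :
  pairing (excursion n) (fun x => (P x j)%:E) = passage P j n j.
Proof.
rewrite -[n in RHS]addn0 -[fun x => _]/(passage P j 0).
elim: n 0%N => [|n IHn] k; first by rewrite pairing_excursion0// passage_ge0.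
rewrite pairing_excursionS; last by move=> x; exact: passage_ge0.
by rewrite -[mean P _]/(passage P j k.+1) IHn addnS.
Qed.

Lemma excursion_mass n :
  pairing (excursion n) (cst 1) =
  passage P j n j + pairing (excursion n.+1) (cst 1).
Proof.
rewrite pairing_excursionS// -excursion_return -pairingD//; last first.
  by move=> x; apply: mean_ge0 => //; apply: off_ge0.
by congr pairing; apply/funext => x /=; rewrite mean_split1.
Qed.

(** Conservation of mass: at time [n] the excursion is either running or over.
*)
Lemma excursion_mass_hit n :
  pairing (excursion n) (cst 1) + hit_within P j n j = 1.
Proof.
elim: n => [|n IHn].
  by rewrite pairing_excursion0//= /hit_within big_geq// adde0.
rewrite -[RHS]IHn (excursion_mass n) /hit_within big_nat_recr//=.
by rewrite addeCA [RHS]addeC; congr (_ + _); exact: addeC.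
Qed.

Lemma pairing_excursion_measure f : (forall x, 0 <= f x) ->
  pairing excursion_measure f = \sum_(0 <= n <oo) pairing (excursion n) f.
Proof.
move=> f0; rewrite pairingC pairing_nneseries//.
by apply: eq_eseriesr => n _; rewrite pairingC.
Qed.

Hypothesis hitj : hit P j j = 1.

Lemma excursion_measure_root : excursion_measure j = 1.
Proof.
rewrite /excursion_measure nneseries_shift//= /at_node eqxx eseries0 ?adde0//.
by move=> n _ _; rewrite /off eqxx.
Qed.

(** Away from [j] this is the recursion for [excursion]; at [j] it says that the
excursion ends almost surely. *)
Lemma excursion_measure_invariant y :
  push P excursion_measure y = excursion_measure y.
Proof.
rewrite /push pairing_excursion_measure//.
have [->|yj] := eqVneq y j.
  rewrite excursion_measure_root -[RHS]hitj; apply: eq_eseriesr => n _.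
  exact: excursion_return.
rewrite /excursion_measure nneseries_shift//= /at_node (negPf yj) add0e.
by apply: eq_eseriesr => n _; rewrite /off (negPf yj).
Qed.

(** The identity says that [nu] annihilates [mean P h - h = B - A].  Summing
over the first [N] steps of the excursion telescopes, and the remainder
[pairing (excursion N) h] is at most the mass of [excursion N], as [h] is
bounded by 1. *)
Lemma harmonic_balance h A B : (forall x, 0 <= h x <= 1) -> h j = 0 ->
  (forall x, 0 <= A x) -> (forall x, 0 <= B x) ->
  (forall x, mean P h x + A x = h x + B x) ->
  pairing excursion_measure A = pairing excursion_measure B.
Proof.
move=> h01 hj A0 B0 eqAB.
have h0 x : 0 <= h x by case/andP: (h01 x).
have offh : off j h = h.
  by apply/funext => x; rewrite /off; case: eqVneq => // ->; rewrite hj.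
have step n : pairing (excursion n.+1) h + pairing (excursion n) A =
              pairing (excursion n) h + pairing (excursion n) B.
  rewrite pairing_excursionS// offh -!pairingD//; last first.
    by move=> x; apply: mean_ge0.
  by congr pairing; apply/funext => x; exact: eqAB.
have tele N :
    pairing (excursion N) h + \sum_(0 <= n < N) pairing (excursion n) A =
    \sum_(0 <= n < N) pairing (excursion n) B.
  elim: N => [|N IHN].
    by rewrite !big_geq// adde0 pairing_excursion0// hj.
  by rewrite !big_nat_recr//= addeCA step addeCA addeA IHN.
have a0 n : 0 <= pairing (excursion n) A by apply: pairing_ge0.
have b0 n : 0 <= pairing (excursion n) B by apply: pairing_ge0.
rewrite !pairing_excursion_measure//.
apply/eqP; rewrite eq_le; apply/andP; split.
  apply: nneseries_le => // N; apply: le_trans (nneseries_lim_ge N _) => //.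
  by rewrite -tele leeDr// pairing_ge0.
(* Adding 1 to both sides, as the sum of the return probabilities, absorbs the
   remainder: it and the part of the excursion that is over add up to at
   most 1. *)
rewrite -(@leeD2rE _ 1)//.
rewrite -[X in _ + X <= _]hitj -nneseriesD//; last first.
  by move=> n _ _; exact: passage_ge0.
apply: nneseries_le => [n|N]; first by rewrite adde_ge0// passage_ge0.
rewrite big_split/= -tele addeAC addeC.
apply: leeD; first exact: nneseries_lim_ge.
rewrite -(excursion_mass_hit N) leeD2r// pairing_le// => x.
by case/andP: (h01 x).
Qed.

End OneKernel.
End Excursions.

(** * Uniqueness of the stationary measure *)
Section Stationarity.
Variables (R : realType) (V : countType) (E : rel V) (P : V -> V -> R) (j : V).
Hypothesis sc : strongly_connected E.
Hypothesis stochP : stochastic P.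
Hypothesis Epos : forall x y, E x y -> (0 < P x y)%R.
Hypothesis hitj : hit P j j = 1.

Local Notation nu := (excursion_measure P j).

Let row0 x y : 0 <= (P x y)%:E. Proof. by rewrite lee_fin; case: stochP. Qed.
Hint Resolve row0 : core.
Let exc0 n y : 0 <= excursion P j n y. Proof. exact: excursion_ge0. Qed.
Let nu0 y : 0 <= nu y. Proof. exact: excursion_measure_ge0. Qed.
Hint Resolve exc0 nu0 : core.

(** By invariance [nu x * P x y <= nu y], so an infinite value would propagate
along a path to [j], where [nu] is 1. *)
Lemma excursion_measure_fin y : nu y \is a fin_num.
Proof.
move: y; apply: (backward_ind sc (r := j)) => [|x y Exy fy].
  by rewrite excursion_measure_root.
rewrite ge0_fin_numE// ltey; apply/eqP => nux.
have := push_term stochP x y nu0.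
rewrite excursion_measure_invariant// nux gt0_mulye ?lte_fin ?Epos//.
by rewrite leye_eq => /eqP nuy; rewrite nuy in fy.
Qed.

Lemma excursion_measure_gt0 y : 0 < nu y.
Proof.
move: y; apply: (forward_ind sc (r := j)) => [|x y Exy x0].
  by rewrite excursion_measure_root.
rewrite -(excursion_measure_invariant stochP hitj).
apply: lt_le_trans (push_term stochP x y nu0).
by rewrite mule_gt0// lte_fin Epos.
Qed.

(** An invariant measure with mass [c] at [j] dominates [c] times the expected
visits during the first [N] steps of the excursion, by induction on [N]. *)
Lemma excursion_measure_minimal c m : (0 <= c)%R -> (forall x, 0 <= m x) ->
  (forall y, push P m y = m y) -> c%:E <= m j -> forall y, c%:E * nu y <= m y.
Proof.
move=> c0 m0 inv mj y.
have -> : c%:E * nu y = \sum_(0 <= n <oo) c%:E * excursion P j n y.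
  rewrite /excursion_measure !nneseries_esumT ?esumZl// => n.
  by rewrite mule_ge0.
apply: nneseries_le => [n|N]; first by rewrite mule_ge0.
elim: N y => [|N IHN] y; first by rewrite big_geq.
rewrite big_nat_recl//= /at_node /off; case: eqVneq => [->|yj].
  by rewrite mule1 big1 ?adde0// => n _; rewrite mule0.
rewrite mule0 add0e -inv.
rewrite (eq_bigr (fun n => push P (fun x => c%:E * excursion P j n x) y)).
  rewrite /push -pairing_suml => [|x|n x]; rewrite ?mule_ge0//.
  by apply: le_esum => x _; rewrite lee_wpmul2r.
move=> n _; rewrite /push pairingC -pairingZ//.
by rewrite pairingC.
Qed.

(** By minimality [D = p - p j * nu] is a nonnegative invariant measure.  It
vanishes at [j], hence, by [D x * P x y <= D y], at every node that leads to
[j]. *)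
Lemma invariant_ratio (p : V -> R) : (forall x, (0 < p x)%R) ->
  (forall y, push P (fun x => (p x)%:E) y = (p y)%:E) ->
  forall y, (p y / p j)%R = fine (nu y).
Proof.
move=> p0 inv y.
pose D x := (p x)%:E - (p j)%:E * nu x.
have nuE x : nu x = (fine (nu x))%:E by rewrite fineK// excursion_measure_fin.
have D0 x : 0 <= D x.
  rewrite sube_ge0; last by rewrite nuE.
  apply: (excursion_measure_minimal (m := fun x => (p x)%:E)) => //.
    exact: ltW.
  by move=> z; rewrite lee_fin ltW.
have Dnu x : D x + (p j)%:E * nu x = (p x)%:E by rewrite /D subeK// nuE.
have invD x : push P D x = D x.
  have : push P D x + (p j)%:E * nu x = D x + (p j)%:E * nu x.
    rewrite Dnu -[RHS]inv -[in LHS](excursion_measure_invariant stochP hitj).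
    have pj0 : 0 <= (p j)%:E by rewrite lee_fin ltW.
    rewrite /push ![pairing _ (fun _ => (P _ _)%:E)]pairingC -pairingZ//.
    rewrite -pairingD// => [|z]; last by rewrite mule_ge0.
    by congr pairing; apply/funext => z; rewrite Dnu.
  rewrite nuE -EFinM => /(congr1 (fun z => z - (p j * fine (nu x))%:E)).
  by rewrite !addeK.
have Dz x : D x = 0.
  move: x; apply: (backward_ind sc (r := j)) => [|x z Exz Dz].
    by rewrite /D excursion_measure_root// mule1 subee.
  apply/eqP; rewrite eq_le D0 andbT leNgt; apply/negP => Dx.
  have := push_term stochP x z D0.
  by rewrite invD Dz leNgt mule_gt0// lte_fin Epos.
have := Dnu y; rewrite Dz add0e nuE -EFinM => -[<-].
by rewrite mulrAC divff ?mul1r// gt_eqF.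
Qed.

End Stationarity.

(** * A harmonic function separating the two nodes *)

(** Perron's method, as an instance of the Knaster-Tarski theorem: the supremum
of the subsolutions below a supersolution is a solution.  No convergence
argument is needed to obtain harmonic functions in this way. *)
Lemma fixpoint_between (R : realType) (T : Type)
    (F : (T -> \bar R) -> T -> \bar R) (lo hi : T -> \bar R) :
  (forall f g, (forall x, f x <= g x) -> forall x, F f x <= F g x) ->
  (forall x, lo x <= F lo x) -> (forall x, F hi x <= hi x) ->
  (forall x, lo x <= hi x) ->
  exists h, [/\ forall x, lo x <= h x, forall x, h x <= hi x &
                forall x, F h x = h x].
Proof.
move=> mono loF Fhi lohi.
pose S := [set f | (forall x, f x <= hi x) /\ (forall x, f x <= F f x)].
pose h x := ereal_sup [set f x | f in S].
have hub f x : S f -> f x <= h x.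
  by move=> Sf; apply: ereal_sup_ubound; exists f.
have hhi x : h x <= hi x by apply: ge_ereal_sup => _ [f [fhi _] <-].
have hF x : h x <= F h x.
  apply: ge_ereal_sup => _ [f Sf <-]; apply: le_trans (mono f h _ x).
    by case: Sf.
  by move=> y; exact: hub.
exists h; split => // [x|x]; first by apply: hub; split.
apply/eqP; rewrite eq_le hF andbT; apply: (hub (F h)); split => y.
  exact: le_trans (mono _ _ hhi y) (Fhi y).
exact: mono.
Qed.

Section Ancestors.
Variables (V : countType) (E : rel V).
Implicit Types (D : pred V) (i j x y : V).

(** Walks may be used in place of paths, since loops can be cut out. *)
Lemma ancestorsP D i x :
  ancestors E D i x <->
  exists p, [/\ path E x p, last x p = i & all D (x :: p)].
Proof.
split=> [[p /and4P[pp /eqP lp _ allp]]|[p [pp lp]]]; first by exists p.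
case/shortenP: pp lp => p' pp' up' sub lp' allp; exists p'.
apply/and4P; split => //; first by rewrite lp'.
apply/allP => z; rewrite inE => /orP[/eqP->|/sub zp].
  by case/andP: allp.
by apply: (allP allp); rewrite inE zp orbT.
Qed.

Lemma ancestors_self D i : D i -> ancestors E D i i.
Proof. by move=> Di; apply/ancestorsP; exists [::]; rewrite /= Di. Qed.

Lemma ancestors_pred D i x y : D x -> E x y -> ancestors E D i y ->
  ancestors E D i x.
Proof.
move=> Dx Exy /ancestorsP[p [pp lp allp]]; apply/ancestorsP.
by exists (y :: p); rewrite /= Exy Dx.
Qed.

Lemma ancestors_in D i x : ancestors E D i x -> D x.
Proof. by move=> /ancestorsP[p [_ _ /= /andP[]]]. Qed.

Lemma ancestors_ind D i (S : V -> Prop) : S i ->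
  (forall x y, D x -> E x y -> ancestors E D i y -> S y -> S x) ->
  forall x, ancestors E D i x -> S x.
Proof.
move=> Si step x /ancestorsP[p]; elim: p x => [|y p IHp] x [/=].
  by move=> _ ->.
move=> /andP[Exy pp] lp /andP[Dx allp].
apply: (step x y) => //; first by apply/ancestorsP; exists p.
exact: IHp.
Qed.

(** On a path to [i], consider the first node among [i] and [j]. *)
Lemma ancestors_cover i j x : strongly_connected E -> i != j ->
  ancestors_del E j i x \/ ancestors_del E i j x.
Proof.
move=> sc ij; move: x; apply: (backward_ind sc (r := i)).
  by left; apply: ancestors_self.
move=> x y Exy.
have [->|xi] := eqVneq x i; first by left; apply: ancestors_self.
have [->|xj] := eqVneq x j.
  by right; apply: ancestors_self; rewrite /= eq_sym.
by case=> [ay|ay]; [left|right]; apply: ancestors_pred Exy ay.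
Qed.

End Ancestors.

Section HarmonicSeparation.
Variables (R : realType) (V : countType) (E : rel V) (P : V -> V -> R).
Variables i j : V.
Hypothesis sc : strongly_connected E.
Hypothesis stochP : stochastic P.
Hypothesis Ezero : forall x y, ~~ E x y -> P x y = 0%R.
Hypothesis ij : i != j.

Local Notation Ai := (ancestors_del E j i).
Local Notation Aj := (ancestors_del E i j).

Definition indicator (S : set V) x : \bar R := if x \in S then 1 else 0.

Lemma indicator01 S x : 0 <= indicator S x <= 1.
Proof. by rewrite /indicator; case: ifP; rewrite ?lexx ?lee01. Qed.

Lemma eq_mean_edges f g x : (forall y, E x y -> f y = g y) ->
  mean P f x = mean P g x.
Proof.
move=> fg; apply: eq_esum => y _.
by have [/fg->//|/Ezero->] := boolP (E x y); rewrite !mul0e.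
Qed.

(** The two boundary indicators bound the solution.  A node outside [Aj] other
than [i] has no edge into [Aj], so the indicator of the complement of [Aj] is a
subsolution; symmetrically the indicator of [Ai] is a supersolution.  They are
ordered since [Ai] and [Aj] cover the graph. *)
Lemma harmonic_separation : exists h : V -> \bar R,
  [/\ forall x, 0 <= h x <= 1, h i = 1, h j = 0,
      forall x, x != i -> x != j -> mean P h x = h x &
      (forall x, ~ Aj x -> h x = 1) /\ (forall x, ~ Ai x -> h x = 0)].
Proof.
pose F f x := if x == i then 1 else if x == j then 0 else mean P f x.
pose lo := indicator (~` Aj); pose hi := indicator Ai.
have Aii : Ai i by apply: ancestors_self.
have Ajj : Aj j by apply: ancestors_self; rewrite /= eq_sym.
have nAji : ~ Aj i by move=> /ancestors_in; rewrite /= eqxx.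
have nAij : ~ Ai j by move=> /ancestors_in; rewrite /= eqxx.
have [||||h [loh hhi Fh]] := @fixpoint_between R V F lo hi.
- move=> f g fg x; rewrite /F; case: ifP => // _; case: ifP => // _.
  exact: mean_le.
- move=> x; rewrite /F; case: eqVneq => [_|xi].
    by case/andP: (indicator01 (~` Aj) x).
  case: eqVneq => [->|xj].
    by rewrite /lo /indicator memNset.
  rewrite {1}/lo /indicator; case: ifPn => [|_]; last first.
    by apply: mean_ge0 => // y; case/andP: (indicator01 (~` Aj) y).
  rewrite inE /= => nAx; rewrite (@eq_mean_edges _ (cst 1)).
    by rewrite mean_cst.
  move=> y Exy; rewrite /lo /indicator mem_set//= => Ay; apply: nAx.
  exact: ancestors_pred Exy Ay.
- move=> x; rewrite /F; case: eqVneq => [->|xi].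
    by rewrite /hi /indicator mem_set.
  case: eqVneq => [_|xj]; first by case/andP: (indicator01 Ai x).
  rewrite {2}/hi /indicator; case: ifPn => [_|].
    rewrite -[leRHS](mean_cst stochP x (c := 1))//; apply: mean_le => // y.
    by case/andP: (indicator01 Ai y).
  rewrite notin_setE => nAx; rewrite (@eq_mean_edges _ (cst 0)).
    by rewrite mean_cst.
  move=> y Exy; rewrite /hi /indicator memNset//= => Ay; apply: nAx.
  exact: ancestors_pred Exy Ay.
- move=> x; rewrite /lo {1}/indicator; case: ifPn => [|_].
    rewrite inE => nAjx.
    by rewrite /hi /indicator mem_set//; case: (ancestors_cover x sc ij).
  by case/andP: (indicator01 Ai x).
have h01 x : 0 <= h x <= 1.
  rewrite (le_trans _ (loh x)) ?(le_trans (hhi x))//.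
    by case/andP: (indicator01 Ai x).
  by case/andP: (indicator01 (~` Aj) x).
have h1 x : ~ Aj x -> h x = 1.
  move=> nAx; apply/eqP; rewrite eq_le; case/andP: (h01 x) => _ ->/=.
  by have := loh x; rewrite /lo /indicator mem_set.
have h0 x : ~ Ai x -> h x = 0.
  move=> nAx; apply/eqP; rewrite eq_le; case/andP: (h01 x) => -> _.
  by have := hhi x; rewrite /hi /indicator memNset// => ->.
exists h; split => //; [exact: h1|exact: h0|].
by move=> x xi xj; rewrite -[RHS]Fh /F (negPf xi) (negPf xj).
Qed.

Lemma joint_ancestor_choice (T : Type) (h : V -> T) (a b : T) :
  a <> b -> joint_ancestors E i j !=set0 ->
  (forall x, ~ Aj x -> h x = a) -> (forall x, ~ Ai x -> h x = b) ->
  exists k y, [/\ joint_ancestors E i j k, E k y & h y <> h k].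
Proof.
move=> ab [k0 [Aik0 Ajk0]] ha hb; apply: contrapT => none.
have same x y : Ai x -> Aj x -> E x y -> h y = h x.
  move=> Aix Ajx Exy; apply: contrapT => hyx.
  by apply: none; exists x, y; split.
have nAji : ~ Aj i by move=> /ancestors_in; rewrite /= eqxx.
have nAij : ~ Ai j by move=> /ancestors_in; rewrite /= eqxx.
have hAi : forall x, Ai x -> h x = a.
  apply: (@ancestors_ind _ _ _ _ (fun x => h x = a)); first exact: ha.
  move=> x y Dx Exy Aiy hy.
  have [Ajx|/ha//] := pselect (Aj x).
  by rewrite -hy; apply/esym/same => //; apply: ancestors_pred Exy Aiy.
have hAj : forall x, Aj x -> h x = b.
  apply: (@ancestors_ind _ _ _ _ (fun x => h x = b)); first exact: hb.
  move=> x y Dx Exy Ajy hy.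
  have [Aix|/hb//] := pselect (Ai x).
  by rewrite -hy; apply/esym/same => //; apply: ancestors_pred Exy Ajy.
by apply: ab; rewrite -(hAi k0)// (hAj k0).
Qed.

End HarmonicSeparation.

(** * Recurrent kernels on a strongly connected graph *)
Section Construction.
Variables (R : realType) (V : countType) (E : rel V).
Hypothesis sc : strongly_connected E.

(** The second node [x0] only serves to give the root an outgoing edge. *)
Lemma descent_to_root r x0 : x0 != r -> exists (d : V -> nat) (next : V -> V),
  (forall x, E x (next x)) /\ (forall x, x != r -> (d (next x) < d x)%N).
Proof.
move=> x0r.
pose reach n x := exists p, [/\ path E x p, last x p = r & size p = n].
have exreach x : exists n, `[< reach n x >].
  have [p /and4P[pp /eqP lp _ _]] := sc x r.
  by exists (size p); apply/asboolP; exists p.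
pose d x := ex_minn (exreach x).
have out x : exists y, E x y /\ (x != r -> (d y < d x)%N).
  rewrite /d; have [->|xr] := eqVneq x r.
    have [[|y p] /and4P[/= pp /eqP lp _ _]] := sc r x0.
      by rewrite lp eqxx in x0r.
    by exists y; case/andP: pp.
  case: ex_minnP => n /asboolP[[|y p] [/= pp lp sp]] _.
    by rewrite lp eqxx in xr.
  case/andP: pp => Exy pp; exists y; split => // _.
  case: ex_minnP => m _ /(_ (size p)) mp; rewrite -sp ltnS; apply: mp.
  by apply/asboolP; exists p.
have [next nextP] := choice out.
by exists d, next; split=> x; have [] := nextP x.
Qed.

Definition node_weight (y : V) : R := (1 / (2 ^ (pickle y + 1))%:R)%R.

Lemma node_weight_gt0 y : (0 < node_weight y)%R.
Proof. by rewrite /node_weight divr_gt0// ltr0n expn_gt0. Qed.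

Lemma node_weight_sum : \esum_(y in setT) (node_weight y)%:E < +oo.
Proof.
pose g n : \bar R := ((1 : R) / (2 ^ (n + 1))%:R)%:E.
have g0 n : 0 <= g n by rewrite lee_fin divr_ge0.
apply: (@le_lt_trans _ _ (\sum_(0 <= n <oo) g n)).
  rewrite -(@esum_image _ _ _ setT pickle g); last first.
    by move=> x y _ _; exact: (pcan_inj pickleK).
  rewrite nneseries_esumT// esum_mkcond; apply: le_esum => n _.
  by case: ifP.
by have /cvg_lim -> := @cvg_geometric_eseries_half R 1 0; rewrite ?ltry.
Qed.

(** Row [x] puts mass [1 - e x] on the descending edge and spreads [e x] over
all edges in proportion to summable positive weights. *)
Lemma base_kernel r x0 : x0 != r -> exists P : V -> V -> R,
  [/\ stochastic P, forall x y, E x y -> (0 < P x y)%R,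
      forall x y, ~~ E x y -> P x y = 0%R & forall x, hit P r x = 1].
Proof.
move=> x0r; have [d [next [Enext desc]]] := descent_to_root x0r.
pose w x y : R := if E x y then node_weight y else 0%R.
have w0 x y : (0 <= w x y)%R.
  by rewrite /w; case: ifP => // _; rewrite ltW// node_weight_gt0.
pose W x := \esum_(y in setT) (w x y)%:E.
have Wfin x : W x \is a fin_num.
  rewrite ge0_fin_numE; last by apply: esum_ge0 => y _; rewrite lee_fin.
  apply: le_lt_trans node_weight_sum; apply: le_esum => y _.
  by rewrite lee_fin /w; case: ifP => // _; rewrite ltW// node_weight_gt0.
have Wpos x : 0 < W x.
  apply: (@lt_le_trans _ _ (w x (next x))%:E).
    by rewrite lte_fin /w Enext node_weight_gt0.
  by apply: (@esum_term _ _ (fun y => (w x y)%:E)) => y; rewrite lee_fin.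
have fWpos x : (0 < fine (W x))%R by rewrite fine_gt0// Wpos ltey_eq Wfin.
pose e x : R := ((d x).+1%:R^-1 ^+ 2)%R.
have e0 x : (0 < e x)%R by rewrite /e exprn_gt0// invr_gt0.
have e1 x : (e x <= 1)%R.
  by rewrite /e exprn_ile1// ?invr_ge0// invf_le1 ?ltr0n// ler1n.
pose P x y : R := ((1 - e x) *+ (y == next x) + e x / fine (W x) * w x y)%R.
have c0 x : (0 < e x / fine (W x))%R by rewrite divr_gt0.
have P0 x y : (0 <= P x y)%R.
  by rewrite /P addr_ge0 ?mulrn_wge0 ?subr_ge0// mulr_ge0// ltW.
have sP : stochastic P.
  split => // x; rewrite /mean /pairing.
  under eq_esum do rewrite mule1 EFinD.
  rewrite esumD => [|y _|y _]; last 2 first.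
  - by rewrite lee_fin mulrn_wge0// subr_ge0.
  - by rewrite lee_fin mulr_ge0// ltW.
  have -> : \esum_(y in setT) ((1 - e x) *+ (y == next x))%:E = (1 - e x)%:E.
    rewrite -[RHS]mul1e -(@pairing_at _ _ (cst 1) (next x)); last first.
      by rewrite mul1e lee_fin subr_ge0.
    apply: eq_esum => y _; rewrite /at_node mul1e.
    by case: eqVneq; rewrite ?mulr1n ?mulr0n.
  under eq_esum do rewrite EFinM.
  rewrite esumZl; last 2 first.
  - by rewrite lee_fin ltW.
  - by move=> y; rewrite lee_fin.
  rewrite -[X in _ * X]fineK ?Wfin// -EFinM divfK ?gt_eqF// -EFinD.
  by rewrite subrK.
exists P; split => //.
- move=> x y Exy; rewrite /P ltr_wpDl// ?mulrn_wge0 ?subr_ge0// mulr_gt0//.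
  by rewrite /w Exy node_weight_gt0.
- move=> x y nExy; rewrite /P /w (negPf nExy) mulr0 addr0.
  by case: eqVneq nExy => // ->; rewrite Enext.
- apply: (hit_certain_of_descent sP desc) => x _.
  by rewrite /P eqxx mulr1n lerDl mulr_ge0// ltW.
Qed.

(** Averaging with a unit mass at [b] keeps every edge weight of row [k]
positive. *)
Definition mix_row P (k b : V) x y : R :=
  if x == k then ((P x y + (y == b)%:R) / 2)%R else P x y.

(** Stated as a doubled identity to stay within sums of nonnegative terms. *)
Lemma mean_mix_row P k b f : stochastic P -> (forall x, 0 <= f x) ->
  mean (mix_row P k b) f k + mean (mix_row P k b) f k = mean P f k + f b.
Proof.
move=> [P0 _] f0; have M0 y : 0 <= (mix_row P k b k y)%:E.
  by rewrite lee_fin /mix_row eqxx divr_ge0// addr_ge0.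
have PE0 y : 0 <= (P k y)%:E by rewrite lee_fin.
rewrite /mean [pairing (fun y => (mix_row _ _ _ _ _)%:E) f]pairingC -pairingD//.
rewrite pairingC.
have -> : (fun y => (mix_row P k b k y)%:E) \+ (fun y => (mix_row P k b k y)%:E)
    = (fun y => (P k y)%:E) \+ at_node b 1.
  apply/funext => y /=; rewrite -EFinD /mix_row eqxx -splitr EFinD /at_node.
  by case: eqVneq.
rewrite pairingC (@pairingD _ _ f _ (at_node b 1))//; last exact: at_node_ge0.
by rewrite pairing_at mule1// pairingC.
Qed.

Lemma mix_row_stochastic P k b : stochastic P -> stochastic (mix_row P k b).
Proof.
move=> sP; have [P0 P1] := sP; split => [x y|x].
  by rewrite /mix_row; case: ifP => // _; rewrite divr_ge0// addr_ge0.
have [->|xk] := eqVneq x k; last first.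
  by rewrite -[RHS](P1 x) /mean /mix_row (negPf xk).
have := @mean_mix_row P k b (cst 1) sP (fun=> lee01); rewrite P1.
case: mean => [s| |]//; rewrite -!EFinD => -[ss].
by congr EFin; lra.
Qed.

End Construction.

(** * Kernels as instantiations *)
Section StochasticInstantiation.
Variables (R : realType) (V : countType) (E : rel V) (P : V -> V -> R).
Hypothesis stochP : stochastic P.
Hypothesis Epos : forall x y, E x y -> (0 < P x y)%R.
Hypothesis Ezero : forall x y, ~~ E x y -> P x y = 0%R.

Lemma stochastic_out_weight x : out_weight E P x = 1.
Proof.
case: stochP => _ /(_ x) <-; rewrite /out_weight esum_mkcond.
apply: eq_esum => y _; rewrite mule1.
case: (boolP (E x y)) => [Exy|nExy]; first by rewrite mem_set.
by rewrite memNset ?Ezero//=; exact/negP.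
Qed.

Lemma stochastic_instantiation c : instantiation E c P.
Proof. by split => // x; case: c; rewrite stochastic_out_weight ?ltry. Qed.

Lemma first_passageE u n x : first_passage E P u n x = passage P u n x.
Proof.
have jumpE y z : jump_prob E P y z = P y z.
  by rewrite /jump_prob stochastic_out_weight divr1.
elim: n x => [|n IHn] x /=; first by rewrite jumpE.
rewrite esum_mkcond; apply: eq_esum => y _; rewrite jumpE IHn /off.
case: eqVneq => [->|yu]; last by rewrite mem_set.
by rewrite memNset ?mule0//= eqxx.
Qed.

Lemma hit_recurrent : (forall u, hit P u u = 1) -> recurrent E P.
Proof.
move=> hit1 u; rewrite -[RHS](hit1 u); apply: eq_eseriesr => n _.
exact: first_passageE.
Qed.

Lemma stationary_push p : stationary_measure E P p <->
  (forall x, (0 < p x)%R) /\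
  (forall y, push P (fun x => (p x)%:E) y = (p y)%:E).
Proof.
have inflow y : \esum_(v in [set v | E v y]) (p v * P v y)%:E =
    push P (fun x => (p x)%:E) y.
  rewrite esum_mkcond; apply: eq_esum => x _.
  case: (boolP (E x y)) => [Exy|nExy]; first by rewrite mem_set.
  by rewrite memNset ?Ezero ?mule0//=; exact/negP.
by split=> -[p0 inv]; split => // y; have := inv y;
  rewrite stochastic_out_weight mule1 inflow.
Qed.

Lemma stationary_ratio_excursion i j : strongly_connected E ->
  (forall u, hit P u u = 1) ->
  stationary_ratio E P i j (fine (excursion_measure P j i)).
Proof.
move=> sc hit1; split; last first.
  by move=> p /stationary_push[p0 inv]; apply: invariant_ratio.
exists (fine \o excursion_measure P j).
apply/stationary_push; split => [x|y] /=.
  by rewrite fine_gt0// (excursion_measure_gt0 sc)//= ltey_eq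
    (excursion_measure_fin sc).
rewrite fineK ?(excursion_measure_fin sc)// -[RHS]excursion_measure_invariant//.
by congr push; apply/funext => x; rewrite fineK// (excursion_measure_fin sc).
Qed.

End StochasticInstantiation.

(** * Dependence of the ratio on one row *)

(** [harmonic_balance] for a function that is harmonic off three nodes.  The
same [h] serves for two kernels that differ in row [k]. *)
Lemma harmonic_excursion_eq (R : realType) (V : countType) (P : V -> V -> R)
    (i j k : V) (h : V -> \bar R) :
  stochastic P -> hit P j j = 1 -> i != j -> k != i -> k != j ->
  (forall x, 0 <= h x <= 1) -> h i = 1 -> h j = 0 ->
  (forall x, x != i -> x != j -> x != k -> mean P h x = h x) ->
  excursion_measure P j i + excursion_measure P j k * h k =
  excursion_measure P j i * mean P h i +
    (mean P h j + excursion_measure P j k * mean P h k).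
Proof.
move=> sP hitj ij ki kj h01 hi hj harm; pose nu := excursion_measure P j.
have h0 x : 0 <= h x by case/andP: (h01 x).
have mh0 x : 0 <= mean P h x by apply: mean_ge0.
have nu0 x : 0 <= nu x by apply: excursion_measure_ge0.
have at0 u c : 0 <= c -> forall x, 0 <= at_node u c x :> \bar R.
  by move=> c0; exact: at_node_ge0.
have nuj : nu j = 1 by apply: excursion_measure_root.
pose A := at_node i 1 \+ at_node k (h k).
pose B := at_node i (mean P h i) \+
  (at_node j (mean P h j) \+ at_node k (mean P h k)).
have A0 x : 0 <= A x by rewrite adde_ge0// at0.
have B0 x : 0 <= B x by rewrite !adde_ge0// at0.
have : pairing nu A = pairing nu B.
  apply: (harmonic_balance sP hitj h01 hj A0 B0) => x.
  rewrite /A /B /at_node /=; case: (eqVneq x i) => [->|xi].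
    by rewrite (negPf ij) eq_sym (negPf ki) hi !adde0 addeC.
  case: (eqVneq x j) => [->|xj].
    by rewrite eq_sym (negPf kj) hj !adde0 !add0e.
  case: (eqVneq x k) => [->|xk]; first by rewrite !add0e addeC.
  by rewrite !adde0 harm.
rewrite /A /B pairingD//; [|exact: at0|exact: at0].
rewrite pairingD//; [|exact: at0|by move=> x; rewrite adde_ge0// at0].
rewrite pairingD//; [|exact: at0|exact: at0].
by rewrite !pairing_at ?mule_ge0// -/nu nuj mul1e mule1.
Qed.

Theorem theorem21 (R : realType) (c : convention) (V : countType) (E : rel V)
    (i j : V) (hG : strongly_connected E) (hij : i <> j)
    (hJ : joint_ancestors E i j !=set0) :
  exists k : V, joint_ancestors E i j k /\ @ratio_depends_on R V E c i j k.
Proof.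
have ij : i != j by apply/eqP.
have [P [sP Epos Ezero hitP_i]] := @base_kernel R V E hG j i ij.
have hitP := hit_certain_all sP hG Epos hitP_i.
have [h [h01 hi hj harm [h1 h0]]] := harmonic_separation hG sP Ezero ij.
have one0 : (1 : \bar R) <> 0 by move=> /eqP; rewrite onee_eq0.
have [k [b [Jk Ekb hbk]]] := joint_ancestor_choice one0 hJ h1 h0.
exists k; split => //.
have ki : k != i by case: Jk => _ /ancestors_in.
have kj : k != j by case: Jk => /ancestors_in.
pose Q := mix_row P k b.
have sQ : stochastic Q by apply: mix_row_stochastic.
have QP x y : x != k -> Q x y = P x y by rewrite /Q /mix_row => /negPf->.
have EposQ x y : E x y -> (0 < Q x y)%R.
  move=> Exy; rewrite /Q /mix_row; case: ifP => _; last exact: Epos.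
  by rewrite divr_gt0// ltr_wpDr// Epos.
have EzeroQ x y : ~~ E x y -> Q x y = 0%R.
  move=> nExy; rewrite /Q /mix_row Ezero//; case: eqVneq => // xk.
  by case: eqVneq nExy => [->|_ _]; rewrite ?xk ?Ekb// addr0 mul0r.
have hitQ : forall u x, hit Q u x = 1.
  apply: (hit_certain_all sQ hG EposQ (r := k)).
  exact: hit_certain_change_row sP sQ QP (hitP k).
exists P, Q; split.
- split; first exact: stochastic_instantiation.
  by apply: hit_recurrent.
- split; first exact: stochastic_instantiation.
  by apply: hit_recurrent.
- by move=> u v _ uk; rewrite QP.
exists (fine (excursion_measure P j i)), (fine (excursion_measure Q j i)).
split; [exact: stationary_ratio_excursion|exact: stationary_ratio_excursion|].
move=> eqnu.
have balP := harmonic_excursion_eq sP (hitP j j) ij ki kj h01 hi hj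
  (fun x xi xj _ => harm x xi xj).
have harmQ x : x != i -> x != j -> x != k -> mean Q h x = h x.
  by move=> xi xj xk; rewrite -[RHS]harm//; apply: eq_esum => y _; rewrite QP.
have balQ := harmonic_excursion_eq sQ (hitQ j j) ij ki kj h01 hi hj harmQ.
have meanQi : mean Q h i = mean P h i.
  by apply: eq_esum => y _; rewrite QP// eq_sym.
have meanQj : mean Q h j = mean P h j.
  by apply: eq_esum => y _; rewrite QP// eq_sym.
have meanQk := mean_mix_row k b sP (fun x => proj1 (andP (h01 x))).
rewrite -/Q (harm k)// in meanQk; rewrite (harm k)// in balP.
rewrite meanQi meanQj in balQ.
have fin01 a : 0 <= a <= 1 -> exists x : R, a = x%:E.
  by case: a => [x _| /andP[]|/andP[]]//; exists x.
have mean01 W x : stochastic W -> 0 <= mean W h x <= 1.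
  move=> sW; rewrite mean_ge0//= => [|y]; last by case/andP: (h01 y).
  rewrite -[leRHS](mean_cst sW x lee01); apply: mean_le => // y.
  by case/andP: (h01 y).
have nuE (W : V -> V -> R) y : stochastic W ->
    (forall x y, E x y -> (0 < W x y)%R) -> hit W j j = 1 ->
    excursion_measure W j y = (fine (excursion_measure W j y))%:E.
  by move=> sW posW hitW; rewrite fineK// (excursion_measure_fin hG).
have nuk0 : excursion_measure Q j k != 0.
  by rewrite gt_eqF// (excursion_measure_gt0 hG).
move: balP balQ meanQk hbk nuk0.
rewrite (nuE P i)// (nuE P k)// (nuE Q i)// (nuE Q k)// -eqnu.
have [hk ->] := fin01 _ (h01 k); have [hb ->] := fin01 _ (h01 b).
have [mi ->] := fin01 _ (mean01 P i sP).
have [mj ->] := fin01 _ (mean01 P j sP).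
have [mk ->] := fin01 _ (mean01 Q k sQ).
(* [t] is the common value at [i]; [a'] and [b'] are the values at [k] for [P]
   and [Q]. *)
move: (fine _) (fine _) (fine _) => b' a' t.
rewrite -!EFinM -!EFinD => -[balP] [balQ] [meanQk] hbk nuk0; apply: hbk.
have b'0 : b' != 0%R by apply: contra_neq nuk0 => ->.
have : (b' * (mk - hk))%R = 0%R by lra.
move/eqP; rewrite mulf_eq0 (negPf b'0) subr_eq0 => /eqP mkE.
by congr EFin; lra.
Qed.
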